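(* Let $p$ be a prime integer and let $T=\mathbb Z[X,Y]/(XY-p)$. If $I=(n)\subset\mathbb Z$ for an integer $n\in\mathbb Z$, then the Bockstein homomorphism $\beta^{0}_{p,IT}: H^{0}_{IT}(T/pT)\rightarrow H^{1}_{IT}(T/pT)$ is the zero map.
   Context: $H^i_J(-)$ denotes the $i$-th local cohomology with support in the ideal $J$, and $IT=nT$. Bockstein homomorphism: for a Noetherian ring $A$, an ideal $J\subset A$ and a nonzerodivisor $u\in A$, the short exact sequence $0\to A\xrightarrow{u}A\to A/uA\to 0$ induces a long exact sequence $$\cdots\to H^{i-1}_{J}(A/uA)\xrightarrow{\delta^{i-1}_{u,J}} H^{i}_{J}(A)\xrightarrow{u}H^{i}_{J}(A)\xrightarrow{\pi^i_{u,J}} H^{i}_{J}(A/uA) \to\cdots,$$ and $\beta^{i-1}_{u,J}:=\pi^i_{u,J}\circ\delta^{i-1}_{u,J}: H^{i-1}_J(A/uA)\to H^i_J(A/uA)$. Here $A=T$, $u=p$, $J=IT$, $i=1$. *)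

(* Defs.v *)
From HB Require Import structures.
From mathcomp Require Import all_boot all_order all_algebra ring_quotient.
From mathcomp Require Import boolp classical_sets functions.
From mathcomp Require Import mpoly.
Set Implicit Arguments. Unset Strict Implicit. Unset Printing Implicit Defensive.
Import Order.TTheory GRing.Theory Num.Theory.
Local Open Scope classical_set_scope.
Local Open Scope ring_scope.
Local Open Scope quotient_scope.

#[local] Obligation Tactic := idtac.

Record submodule (A : comNzRingType) (M : lmodType A) := Submodule {
  scarrier :> M -> Prop;
  smod0 : scarrier 0;
  smodD : forall x y, scarrier x -> scarrier y -> scarrier (x + y);
  smodZ : forall a x, scarrier x -> scarrier (a *: x) }.

Section Submodule.
Variables (A : comNzRingType) (M : lmodType A) (N : submodule M).

Definition smem : {pred M} := fun x => `[< N x >].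

Lemma smemE x : (x \in smem) = `[< N x >]. Proof. by []. Qed.

Lemma smem_submod : submod_closed smem.
Proof.
split; first by apply/asboolP; exact: smod0.
move=> a x y /asboolP Nx /asboolP Ny; apply/asboolP.
by apply: smodD => //; exact: smodZ.
Qed.
HB.instance Definition _ := GRing.isSubmodClosed.Build A M smem smem_submod.

Lemma smem_zmod : zmod_closed smem.
Proof. exact: (GRing.submod_closedB smem_submod). Qed.

HB.instance Definition _ := GRing.isZmodClosed.Build M smem smem_zmod.

Definition submod := {x : M | x \in smem}.
HB.instance Definition _ := Choice.on submod.
HB.instance Definition _ := SubChoice.on submod.
HB.instance Definition _ := [SubChoice_isSubLmodule of submod by <:].

Lemma submodP (x : submod) : N (val x).
Proof. exact/asboolP/(valP x). Qed.

Definition mk_submod x (Nx : N x) : submod := exist _ x (asboolT Nx).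

Lemma val_mk_submod x (Nx : N x) : val (mk_submod Nx) = x.
Proof. by []. Qed.

Definition quotmod := Quotient.quot smem.
HB.instance Definition _ := EqQuotient.on quotmod.
HB.instance Definition _ := Choice.on quotmod.
HB.instance Definition _ := ZmodQuotient.on quotmod.

Definition qscale (a : A) : quotmod -> quotmod :=
  fun x => \pi_quotmod (a *: repr x).

Definition qproj (x : M) : quotmod := \pi_quotmod x.

Lemma qproj_eq x y : qproj x = qproj y <-> N (x - y).
Proof.
split => [/eqP|Nxy]; first by rewrite -Quotient.idealrBE => /asboolP.
by apply/eqP; rewrite -Quotient.idealrBE; apply/asboolP.
Qed.

Lemma qproj_surj (y : quotmod) : exists x, qproj x = y.
Proof. by exists (repr y); exact: reprK. Qed.

Lemma qproj_zmod : zmod_morphism qproj.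
Proof. by move=> x y; rewrite /qproj !piE. Qed.
HB.instance Definition _ := GRing.isZmodMorphism.Build M quotmod qproj qproj_zmod.

Lemma qscale_qproj a x : qscale a (qproj x) = qproj (a *: x).
Proof.
apply/qproj_eq; rewrite -scalerBr; apply/smodZ/qproj_eq; exact: reprK.
Qed.

Fact qscaleA a b v : qscale a (qscale b v) = qscale (a * b) v.
Proof. by have [x <-] := qproj_surj v; rewrite !qscale_qproj scalerA. Qed.
Fact qscale1 : left_id 1 qscale.
Proof. by move=> v; have [x <-] := qproj_surj v; rewrite qscale_qproj scale1r. Qed.
Fact qscaleDr : right_distributive qscale +%R.
Proof.
move=> a u v; have [x <-] := qproj_surj u; have [y <-] := qproj_surj v.
by rewrite -raddfD !qscale_qproj scalerDr raddfD.
Qed.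
Fact qscaleDl v : {morph qscale^~ v : a b / a + b}.
Proof.
by move=> a b; have [x <-] := qproj_surj v; rewrite !qscale_qproj scalerDl raddfD.
Qed.
HB.instance Definition _ :=
  GRing.Zmodule_isLmodule.Build A quotmod qscaleA qscale1 qscaleDr qscaleDl.

Lemma qproj_scalable : scalable qproj.
Proof. by move=> a x; rewrite -qscale_qproj. Qed.
HB.instance Definition _ := GRing.isScalable.Build A M quotmod *:%R qproj qproj_scalable.

End Submodule.

Section SubmoduleMaps.
Variables (A : comNzRingType) (M N : lmodType A) (f : {linear M -> N}).
Variables (S : submodule M) (T : submodule N).
Hypothesis fST : forall x, S x -> T (f x).

Definition sub_map (x : submod S) : submod T := mk_submod (fST (submodP x)).

Lemma sub_map_linear : linear sub_map.
Proof. by move=> a x y; apply: val_inj; rewrite /= !linearP. Qed.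
HB.instance Definition _ :=
  GRing.isLinear.Build A (submod S) (submod T) *:%R sub_map sub_map_linear.

Definition quot_map of (forall x, S x -> T (f x)) :=
  fun x : quotmod S => qproj T (f (repr x)).

Lemma quot_map_qproj x : quot_map fST (qproj S x) = qproj T (f x).
Proof.
by apply/qproj_eq; rewrite -linearB; apply/fST/qproj_eq; exact: reprK.
Qed.

Lemma quot_map_linear : linear (quot_map fST).
Proof.
move=> a u v; have [x <-] := qproj_surj u; have [y <-] := qproj_surj v.
by rewrite -linearP !quot_map_qproj !linearP.
Qed.
HB.instance Definition _ :=
  GRing.isLinear.Build A (quotmod S) (quotmod T) *:%R (quot_map fST) quot_map_linear.

End SubmoduleMaps.

Section Image.
Variables (A : comNzRingType) (M N : lmodType A) (f : {linear M -> N}).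

Program Definition im_sub : submodule N := @Submodule A N (range f) _ _ _.
Next Obligation. by exists 0; rewrite ?linear0. Qed.
Next Obligation.
by move=> _ _ [u _ <-] [v _ <-]; exists (u + v); rewrite ?linearD.
Qed.
Next Obligation. by move=> a _ [u _ <-]; exists (a *: u); rewrite ?linearZ. Qed.

Program Definition ker_sub : submodule M :=
  @Submodule A M (fun x => f x = 0) _ _ _.
Next Obligation. exact: linear0. Qed.
Next Obligation. by move=> x y /= fx fy; rewrite linearD fx fy addr0. Qed.
Next Obligation. by move=> a x /= fx; rewrite linearZ_LR fx scaler0. Qed.
End Image.

Section Generated.
Variables (A : comNzRingType) (M : lmodType A).

(* The intersection of all submodules containing X. *)
Program Definition gen_sub (X : set M) : submodule M :=
  @Submodule A M (fun x => forall N : submodule M, X `<=` N -> N x) _ _ _.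
Next Obligation. by move=> X K XK; exact: smod0. Qed.
Next Obligation.
by move=> X x y Xx Xy K XK; exact: smodD (Xx K XK) (Xy K XK).
Qed.
Next Obligation. by move=> X a x Xx K XK; exact: smodZ (Xx K XK). Qed.

Program Definition full_sub : submodule M := @Submodule A M setT _ _ _.
Next Obligation. by []. Qed.
Next Obligation. by []. Qed.
Next Obligation. by []. Qed.
End Generated.

(* An ideal of A is a submodule of the regular module A^o. *)
Notation ideal A := (@submodule A A^o).

Fixpoint ideal_pow (A : comNzRingType) (J : ideal A) (k : nat) : ideal A :=
  if k is l.+1
  then @gen_sub A A^o [set c | exists a b : A, [/\ J a, ideal_pow J l b & c = a * b]]
  else @full_sub A A^o.

Section Torsion.
Variables (A : comNzRingType) (J : ideal A).

Lemma ideal_powS k a : ideal_pow J k.+1 a -> ideal_pow J k a.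
Proof. by apply => _ [b [c [_ Jc ->]]]; exact: (smodZ b Jc). Qed.

Lemma ideal_powW k l a : (k <= l)%N -> ideal_pow J l a -> ideal_pow J k a.
Proof.
move/subnK <-; elim: (l - k)%N => // m IH; rewrite addSn => /ideal_powS; exact: IH.
Qed.

(* The m killed by some power of J. *)
Program Definition torsion_sub (M : lmodType A) : submodule M := @Submodule A M
  (fun m => exists k, forall a, ideal_pow J k a -> (a : A) *: m = 0) _ _ _.
Next Obligation. by move=> M; exists 0 => a _; rewrite scaler0. Qed.
Next Obligation.
move=> M x y [k kx] [l ly]; exists (maxn k l) => a Ja.
by rewrite scalerDr kx ?ly ?addr0//; apply: ideal_powW Ja;
  rewrite ?leq_maxl ?leq_maxr.
Qed.
Next Obligation.
by move=> M a x [k kx]; exists k => b /kx; rewrite scalerA mulrC -scalerA => ->;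
  rewrite scaler0.
Qed.

Lemma torsion_sub_map (M N : lmodType A) (f : {linear M -> N}) (m : M) :
  torsion_sub M m -> torsion_sub N (f m).
Proof. by move=> [k km]; exists k => a /km; rewrite -linearZ_LR => ->; rewrite linear0. Qed.

Definition Gamma (M : lmodType A) : lmodType A := submod (torsion_sub M).
Definition Gamma_map (M N : lmodType A) (f : {linear M -> N}) :
  {linear Gamma M -> Gamma N} := sub_map (@torsion_sub_map M N f).
End Torsion.

(* Complexes are concentrated in degrees n >= 0; the missing degree -1 is 0. *)
Record cochain (A : comNzRingType) := Cochain {
  cobj :> nat -> lmodType A;
  cdiff : forall n, {linear cobj n -> cobj n.+1};
  cdiffK : forall n x, cdiff n.+1 (cdiff n x) = 0 }.

Record cochain_map (A : comNzRingType) (C D : cochain A) := CochainMap {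
  cmap :> forall n, {linear C n -> D n};
  cmapE : forall n x, cmap n.+1 (cdiff C n x) = cdiff D n (cmap n x) }.

Section Cohomology.
Variable A : comNzRingType.
Implicit Types C D : cochain A.

Definition cocycles C n : submodule (C n) := ker_sub (cdiff C n).

Definition is_coboundary C n : C n -> Prop :=
  match n with
  | 0 => fun x => x = 0
  | m.+1 => fun x => exists y, cdiff C m y = x
  end.

Lemma is_coboundary_map C D (f : cochain_map C D) n (x : C n) :
  is_coboundary x -> is_coboundary (f n x).
Proof.
by case: n x => [_ ->|n x [y <-]] /=; [rewrite linear0|exists (f n y); rewrite cmapE].
Qed.

Program Definition coboundaries C n : submodule (submod (cocycles C n)) :=
  @Submodule A _ (fun x => is_coboundary (val x)) _ _ _.
Next Obligation.
by move=> C; case=> //= n; exists 0; rewrite linear0.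
Qed.
Next Obligation.
move=> C; case=> [|n] x y /=; first by move=> -> ->; rewrite addr0.
by move=> [u ux] [v vy]; exists (u + v); rewrite linearD ux vy.
Qed.
Next Obligation.
move=> C; case=> [|n] a x /=; first by move=> ->; rewrite scaler0.
by move=> [u ux]; exists (a *: u); rewrite linearZ_LR ux.
Qed.

Definition coh C n : lmodType A := quotmod (coboundaries C n).

Section Functoriality.
Variables (C D : cochain A) (f : cochain_map C D) (n : nat).

Lemma cocycles_map x : cocycles C n x -> cocycles D n (f n x).
Proof. by move=> /= dx; rewrite -cmapE dx linear0. Qed.

Lemma coboundaries_map x :
  coboundaries C n x -> coboundaries D n (sub_map cocycles_map x).
Proof. exact: is_coboundary_map. Qed.

Definition coh_map : {linear coh C n -> coh D n} := quot_map coboundaries_map.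
End Functoriality.

Record short_exact (M1 M2 M3 : lmodType A)
    (f : {linear M1 -> M2}) (g : {linear M2 -> M3}) : Prop := ShortExact {
  sex_inj : injective f;
  sex_mid : forall y, g y = 0 <-> exists x, f x = y;
  sex_surj : forall z, exists y, g y = z }.

Section Connecting.
Variables (C1 C2 C3 : cochain A) (f : cochain_map C1 C2) (g : cochain_map C2 C3).
Hypothesis fg : forall n, short_exact (f n) (g n).
Variable n : nat.

(* The snake lemma relation: w represents the image of the class of z under
   the connecting homomorphism. *)
Definition snake (z : submod (cocycles C3 n)) (w : submod (cocycles C1 n.+1)) :=
  exists2 y, g n y = val z & f n.+1 (val w) = cdiff C2 n y.

Lemma snake_ex z : exists w, snake z w.
Proof.
have [y yz] := sex_surj (fg n) (val z).
have /(sex_mid (fg n.+1)) [x xy] : g n.+1 (cdiff C2 n y) = 0.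
  by rewrite cmapE yz; exact: submodP z.
have cx : cocycles C1 n.+1 x.
  apply: (sex_inj (fg n.+2)); rewrite /= cmapE xy cdiffK linear0 //.
by exists (mk_submod cx), y.
Qed.

Lemma snake_linear a z w z' w' :
  snake z w -> snake z' w' -> snake (a *: z + z') (a *: w + w').
Proof.
move=> [y yz yw] [y' yz' yw']; exists (a *: y + y').
  by rewrite !linearP yz yz'.
by rewrite /= !linearP /= yw yw'.
Qed.

Lemma snake_coboundary z w :
  coboundaries C3 n z -> snake z w -> coboundaries C1 n.+1 w.
Proof.
rewrite /= => bz [y yz yw].
have [y0 dy0 gy0] : exists2 y0, cdiff C2 n y0 = 0 & g n y0 = g n y.
  move: bz; rewrite -yz; case: (n) (y) => [|m] u /=.
    by move=> ->; exists 0; rewrite linear0.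
  move=> [v <-]; have [t <-] := sex_surj (fg m) v.
  by exists (cdiff C2 m t); [exact: cdiffK|rewrite cmapE].
have /(sex_mid (fg n)) [x xy] : g n (y - y0) = 0 by rewrite linearB gy0 subrr.
exists x; apply: (sex_inj (fg n.+1)).
by rewrite cmapE xy linearB dy0 subr0 yw.
Qed.

Definition connecting_fun (z : coh C3 n) : coh C1 n.+1 :=
  qproj _ (projT1 (cid (snake_ex (repr z)))).

Lemma connecting_funE z w : snake z w -> connecting_fun (qproj _ z) = qproj _ w.
Proof.
move=> zw; rewrite /connecting_fun; case: cid => w' /= zw'; apply/qproj_eq.
have := snake_linear (-1) zw zw'; rewrite !scaleN1r ![- _ + _]addrC.
by apply: snake_coboundary; apply/qproj_eq; exact: reprK.
Qed.

Lemma connecting_linear : linear connecting_fun.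
Proof.
move=> a u v; have [x <-] := qproj_surj u; have [y <-] := qproj_surj v.
have [x' xx'] := snake_ex x; have [y' yy'] := snake_ex y.
rewrite -linearP (connecting_funE xx') (connecting_funE yy').
by rewrite (connecting_funE (snake_linear a xx' yy')) linearP.
Qed.
HB.instance Definition _ :=
  GRing.isLinear.Build A (coh C3 n) (coh C1 n.+1) *:%R connecting_fun connecting_linear.

Definition connecting : {linear coh C3 n -> coh C1 n.+1} := connecting_fun.
End Connecting.
End Cohomology.

Section DivisibleExtension.
Variables G H D : zmodType.
Variables (f : G -> H) (h : G -> D).
Hypotheses (fB : zmod_morphism f) (hB : zmod_morphism h).
Hypothesis fh : forall x, f x = 0 -> h x = 0.
Hypothesis divD : forall (d : D) n, (0 < n)%N -> exists e, e *+ n = d.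

Definition pgraph (S : set (H * D)) := [/\ forall x, S (f x, h x),
  forall u v, S u -> S v -> S (u - v) & forall d, S (0, d) -> d = 0].

Lemma pgraph0 : pgraph [set u | exists x, u = (f x, h x)].
Proof.
split=> [x|_ _ [x ->] [y ->]|d [x [fx ->]]]; first by exists x.
  by exists (x - y); rewrite fB hB.
exact/fh.
Qed.

Lemma pgraph_max : exists S, pgraph S /\ forall S', pgraph S' -> S `<=` S' -> S' `<=` S.
Proof.
have [F FP Ftot|S [PS maxS]] := @Zorn_bigcup _ (fun S => S = set0 \/ pgraph S).
  have [[S0 FS0 [p S0p]]|F0] := pselect (exists2 S, F S & S !=set0); last first.
    left; apply/seteqP; split=> // u [S FS Su]; apply: F0; exists S => //.
    by exists u.
  have good S u : F S -> S u -> pgraph S.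
    by move=> FS Su; case: (FP _ FS) => // S_0; rewrite S_0 in Su.
  right; split=> [x|u v [S FS Su] [S' FS' S'v]|d [S FS Sd]].
  - by exists S0 => //; case: (good _ _ FS0 S0p).
  - have [SS'|S'S] := Ftot _ _ FS FS'.
      by exists S' => //; case: (good _ _ FS' S'v) => _ + _; apply=> //; exact: SS'.
    by exists S => //; case: (good _ _ FS Su) => _ + _; apply=> //; exact: S'S.
  - by case: (good _ _ FS Sd) => _ _; apply.
case: PS => [S_0|PS].
  exfalso; have /maxS : S `<` [set u | exists x, u = (f x, h x)].
    by rewrite S_0; split=> // /(_ (f 0, h 0)); apply; exists 0.
  by apply; right; exact: pgraph0.
exists S; split=> // S' PS' SS' u S'u; apply: contrapT => Su.
by apply: (maxS S'); [split=> // /(_ _ S'u)|right].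
Qed.

Lemma pgraph_total S : pgraph S -> (forall S', pgraph S' -> S `<=` S' -> S' `<=` S) ->
  forall y, exists d, S (y, d).
Proof.
move=> [S0 SB SF] maxS y.
have S00 : S 0 by have := SB _ _ (S0 0) (S0 0); rewrite subrr.
have SN u : S u -> S (- u) by move=> /(SB _ _ S00); rewrite sub0r.
have SD u v : S u -> S v -> S (u + v).
  by move=> Su Sv; rewrite -[v]opprK; apply: SB => //; exact: SN.
have SMn u n : S u -> S (u *+ n).
  by move=> Su; elim: n => [|n IH]; rewrite ?mulr0n ?mulrS//; exact: SD.
have SMz u k : S u -> S (u *~ k).
  by move=> Su; case: k => n; [|rewrite NegzE mulrNz; apply: SN]; exact: SMn.
have pairN (a : H) (b : D) : - (a, b) = (- a, - b) by [].
have pairB (a a' : H) (b b' : D) : (a, b) - (a', b') = (a - a', b - b') by [].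
have pairMz (a : H) (b : D) k : (a, b) *~ k = (a *~ k, b *~ k).
  have pairMn n : (a, b) *+ n = (a *+ n, b *+ n).
    by elim: n => // n IH; rewrite !mulrS IH.
  by case: k => n; rewrite ?NegzE ?mulrNz -?pmulrn ?pairMn.
suff [e eP] : exists e : D, forall k c, S (y *~ k, c) -> c = e *~ k.
  pose S' := [set u | exists k v, S v /\ u = (y, e) *~ k + v].
  have SS' : S `<=` S'.
    by move=> u Su; exists 0, u; rewrite mulr0z add0r.
  suff PS' : pgraph S'.
    exists e; apply: (maxS _ PS' SS'); exists 1, 0; rewrite mulr1z addr0.
    by split.
  split=> [x|_ _ [k [u [Su ->]]] [l [v [Sv ->]]]|d [k [[u c] [Su]]]].
  - exact/SS'.
  - exists (k - l), (u - v); split; first exact: SB.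
    by rewrite mulrzBr addrACA opprD.
  - rewrite pairMz => -[/eqP]; rewrite eq_sym addr_eq0 => /eqP yu ->.
    move: Su => /SN; rewrite pairN -yu => /eP <-; exact: addNr.
have [[n [n0 [c nc]]]|noN] := pselect (exists n, (0 < n)%N /\ exists c, S (y *+ n, c)); last first.
  exists 0 => k c; rewrite mul0rz; case: k => n Sk.
    case: n Sk => [|n] Sk; first by apply: SF.
    by exfalso; apply: noN; exists n.+1; split=> //; exists c.
  by exfalso; apply: noN; exists n.+1; split=> //; exists (- c); move: Sk => /SN;
    rewrite NegzE mulrNz pairN opprK.
pose P n := `[< (0 < n)%N /\ exists c, S (y *+ n, c) >].
have exP : exists n, P n by exists n; apply/asboolP; split=> //; exists c.
case: (ex_minnP exP) => m /asboolP[m0 [b mb]] minm.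
have [e em] := divD b m0; exists e => k a Sk.
have kE := divz_eq k m.
have Sr : S (y *~ (k %% m)%Z, a - b *~ (k %/ m)%Z).
  have := SB _ _ Sk (SMz _ (k %/ m)%Z mb); rewrite pairMz pairB; congr S; congr (_, _).
  by rewrite {1}kE mulrzDr pmulrn -mulrzA mulrC addrC addKr.
have r0 : (k %% m)%Z = 0.
  have mn0 : (m : int) != 0 by rewrite eqz_nat -lt0n.
  have rge := modz_ge0 k mn0.
  have rlt : (k %% m)%Z < m by apply: ltz_pmod.
  move: rge rlt Sr; case: ((k %% m)%Z) => // r _; rewrite ltz_nat => rm Sr.
  case: r rm Sr => // r rm Sr; exfalso.
  have /minm : P r.+1 by apply/asboolP; split=> //; exists (a - b *~ (k %/ m)%Z).
  by rewrite leqNgt rm.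
rewrite r0 mulr0z in Sr; move/SF/eqP: Sr; rewrite subr_eq0 => /eqP ->.
by rewrite [in RHS]kE r0 addr0 -em pmulrn -mulrzA mulrC.
Qed.

(* Divisible abelian groups are injective: h extends along f as soon as the
   kernel of f is contained in that of h. *)
Lemma divisible_extension :
  exists2 g : H -> D, zmod_morphism g & forall x, g (f x) = h x.
Proof.
have [S [PS maxS]] := pgraph_max.
have tot := pgraph_total PS maxS; have [S0 SB SF] := PS.
pose g y := projT1 (cid (tot y)).
have gP y : S (y, g y) by rewrite /g; case: cid.
have uniq y d d' : S (y, d) -> S (y, d') -> d = d'.
  move=> Sd Sd'; have : S (y - y, d - d') := SB _ _ Sd Sd'.
  by rewrite subrr => /SF/eqP; rewrite subr_eq0 => /eqP.
exists g => [x y|x]; last exact: uniq (gP _) (S0 _).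
exact: uniq (gP _) (SB _ _ (gP x) (gP y)).
Qed.
End DivisibleExtension.

Section RationalsModIntegers.

Definition rat_int : {pred rat} := fun x => `[< exists k : int, x = k%:~R >].

Lemma rat_int_zmod : zmod_closed rat_int.
Proof.
split=> [|x y /asboolP[k ->] /asboolP[l ->]]; apply/asboolP; first by exists 0.
by exists (k - l); rewrite rmorphB.
Qed.
HB.instance Definition _ := GRing.isZmodClosed.Build rat rat_int rat_int_zmod.

Definition QmodZ : zmodType := Quotient.quot rat_int.

Lemma QmodZ_divisible (d : QmodZ) n : (0 < n)%N -> exists e, e *+ n = d.
Proof.
move=> n0; exists (\pi_QmodZ (repr d / n%:R)); rewrite -raddfMn -[RHS]reprK.
by congr \pi_QmodZ; rewrite -[_ / _ *+ _]mulr_natr divfK// pnatr_eq0 -lt0n.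
Qed.

Lemma QmodZ_eq0 x : \pi_QmodZ x = 0 <-> exists k : int, x = k%:~R.
Proof.
have -> : 0 = \pi_QmodZ 0 by rewrite raddf0.
split => [/eqP|xk].
  by rewrite -Quotient.idealrBE subr0 => /asboolP.
by apply/eqP; rewrite -Quotient.idealrBE subr0; apply/asboolP.
Qed.

Lemma QmodZ_separated (M : zmodType) (m : M) : m != 0 ->
  exists2 g : M -> QmodZ, zmod_morphism g & g m != 0.
Proof.
move=> m0.
have [q qnotint qP] : exists2 q : rat, ~ (exists k : int, q = k%:~R) &
    forall k : int, m *~ k = 0 -> exists l : int, k%:~R * q = l%:~R.
  have notint n : (1 < n)%N -> ~ (exists k : int, (n%:R^-1 : rat) = k%:~R).
    move=> n1 [k nk]; have n0 : (n%:R : rat) != 0 by rewrite pnatr_eq0 -lt0n ltnW.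
    have : (n%:Z * k)%:~R = (1%:Z)%:~R :> rat by rewrite rmorphM/= -nk mulfV.
    move=> /intr_inj/(congr1 absz); rewrite abszM/= => /eqP.
    by rewrite muln_eq1 => /andP[/eqP n1' _]; rewrite n1' in n1.
  have [exn|non] := pselect (exists n, (0 < n)%N && (m *+ n == 0)); last first.
    exists 2%:R^-1; first exact: notint.
    move=> k mk; exists 0; suff -> : k = 0 by rewrite mul0r.
    case: k mk => [[//|n]|n]; rewrite ?NegzE ?mulrNz -?pmulrn => /eqP mk;
      by case: non; exists n.+1; rewrite // -oppr_eq0.
  case: (ex_minnP exn) => n /andP[n0 /eqP mn] minn.
  exists n%:R^-1.
    apply: notint; case: n n0 mn {minn} => [|[|n]] // _ m1.
    by rewrite mulr1n in m1; rewrite m1 eqxx in m0.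
  move=> k mk; exists (k %/ n)%Z.
  have nn0 : (n : int) != 0 by rewrite eqz_nat -lt0n.
  have nq0 : (n%:R : rat) != 0 by rewrite pnatr_eq0 -lt0n.
  have kE := divz_eq k n.
  have r0 : (k %% n)%Z = 0.
    have rge := modz_ge0 k nn0.
    have rlt : (k %% n)%Z < n by apply: ltz_pmod.
    have mr : m *~ (k %% n)%Z = 0.
      move: mk; rewrite {1}kE mulrzDr mulrC mulrzA -pmulrn mn mul0rz add0r; exact.
    move: rge rlt mr; case: ((k %% n)%Z) => // -[//|r] _; rewrite ltz_nat => rn mr.
    have /minn : (0 < r.+1)%N && (m *+ r.+1 == 0) by apply/eqP.
    by rewrite leqNgt rn.
  by rewrite {1}kE r0 addr0 rmorphM/= mulfK.
have [//|||g gB gE] := @divisible_extension int M QmodZ (fun k => m *~ k)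
  (fun k => \pi_QmodZ (k%:~R * q)) _ _ _ QmodZ_divisible.
- by move=> k l; rewrite mulrzBr.
- by move=> k l; rewrite rmorphB/= mulrBl raddfB.
- by move=> k /qP ?; apply/QmodZ_eq0.
exists g => //; apply/eqP => gm; apply: qnotint; apply/QmodZ_eq0.
by rewrite -[q]mul1r -(gE 1) mulr1z.
Qed.

End RationalsModIntegers.

Definition injective_module (A : comNzRingType) (E : lmodType A) :=
  forall (M N : lmodType A) (i : {linear M -> N}) (f : {linear M -> E}),
  injective i -> exists g : {linear N -> E}, forall x, g (i x) = f x.

Lemma zmod_morphismD (U V : zmodType) (f : U -> V) :
  zmod_morphism f -> {morph f : x y / x + y}.
Proof. by move=> fB x y; have := fB (x + y) y; rewrite addrK => ->; rewrite subrK. Qed.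

(* For a set S, coind is the A-module Hom_Z(A, (Q/Z)^S), with
   (a *: h)(s)(b) = h(s)(a * b). *)
Section Coinduced.
Variables (A : comNzRingType) (S : Type).

Definition coind_pred : {pred S -> A -> QmodZ} :=
  fun h => `[< forall s, zmod_morphism (h s) >].

Lemma coind_zmod : zmod_closed coind_pred.
Proof.
split=> [|g h /asboolP gB /asboolP hB]; apply/asboolP => s x y.
  by rewrite subr0.
rewrite !fctE gB hB; exact: (esym (addrACA _ _ _ _)) || rewrite !opprD addrACA //.
Qed.
HB.instance Definition _ := GRing.isZmodClosed.Build _ coind_pred coind_zmod.

Definition coind := {h | h \in coind_pred}.
HB.instance Definition _ := Choice.on coind.
HB.instance Definition _ := SubChoice.on coind.
HB.instance Definition _ := [SubChoice_isSubZmodule of coind by <:].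

Lemma coindP (h : coind) s : zmod_morphism (val h s).
Proof. by have /asboolP := valP h. Qed.

Definition mk_coind (h : S -> A -> QmodZ) (hB : forall s, zmod_morphism (h s)) :
  coind := exist _ h (asboolT hB).

Fact coind_scale_subproof (a : A) (h : coind) s :
  zmod_morphism (fun b => val h s (a * b)).
Proof. by move=> x y; rewrite mulrBr coindP. Qed.
Definition coind_scale a h : coind := mk_coind (coind_scale_subproof a h).

Fact coind_scaleA a b v : coind_scale a (coind_scale b v) = coind_scale (a * b) v.
Proof. by apply: val_inj; apply/funext => s; apply/funext => c /=; rewrite mulrCA mulrA. Qed.
Fact coind_scale1 : left_id 1 coind_scale.
Proof. by move=> v; apply: val_inj; apply/funext => s; apply/funext => c /=; rewrite mul1r. Qed.
Fact coind_scaleDr : right_distributive coind_scale +%R.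
Proof. by move=> a u v; apply: val_inj; apply/funext => s; apply/funext. Qed.
Fact coind_scaleDl v : {morph coind_scale^~ v : a b / a + b}.
Proof.
move=> a b; apply: val_inj; apply/funext => s; apply/funext => c /=.
by rewrite mulrDl; exact: zmod_morphismD (coindP v s) _ _.
Qed.
HB.instance Definition _ := GRing.Zmodule_isLmodule.Build A coind
  coind_scaleA coind_scale1 coind_scaleDr coind_scaleDl.

Lemma coind_injective : injective_module coind.
Proof.
move=> M N i f i_inj.
have ext s : exists2 g : N -> QmodZ, zmod_morphism g & forall x, g (i x) = val (f x) s 1.
  apply: divisible_extension; last exact: QmodZ_divisible.
  - by move=> x y; rewrite linearB.
  - by move=> x y; rewrite linearB.
  - by move=> x /eqP; rewrite -(linear0 i) (inj_eq i_inj) => /eqP ->; rewrite linear0.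
pose g s := projT1 (cid2 (ext s)).
have gB s : zmod_morphism (g s) by rewrite /g; case: cid2.
have gE s x : g s (i x) = val (f x) s 1 by rewrite /g; case: cid2.
have gyP y s : zmod_morphism (fun a : A => g s (a *: y)).
  by move=> a b; rewrite scalerBl gB.
pose G y : coind := mk_coind (gyP y).
have Glin : linear G.
  move=> a x y; apply: val_inj; apply/funext => s; apply/funext => c.
  rewrite /= scalerDr (zmod_morphismD (gB s)) scalerA mulrC.
  by [].
pose GL := GRing.isLinear.Build A N coind *:%R G Glin.
pose G' : {linear N -> coind} := HB.pack G GL.
exists G' => x; apply: val_inj; apply/funext => s; apply/funext => a /=.
by rewrite -linearZ_LR gE linearZ_LR /= mulr1.
Qed.

End Coinduced.

Definition mk_linear (A : comNzRingType) (U V : lmodType A) (f : U -> V)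
    (f_lin : linear f) : {linear U -> V} :=
  let m := GRing.isLinear.Build A U V *:%R f f_lin in HB.pack f m.

Lemma injective_extend (A : comNzRingType) (E X Y : lmodType A)
    (f : {linear X -> Y}) (h : {linear X -> E}) :
  injective_module E -> (forall x, f x = 0 -> h x = 0) ->
  exists g : {linear Y -> E}, forall x, g (f x) = h x.
Proof.
move=> E_inj fh.
have imP (y : submod (im_sub f)) : exists x, f x = val y.
  by have [x _ xy] := submodP y; exists x.
pose k y := h (projT1 (cid (imP y))).
have kE y x : f x = val y -> k y = h x.
  rewrite /k; case: cid => x' /= x'y xy; apply/eqP; rewrite -subr_eq0 -linearB.
  by apply/eqP/fh; rewrite linearB x'y xy subrr.
have k_lin : linear k.
  move=> a y z; have [u uy] := imP y; have [v vz] := imP z.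
  rewrite (kE y u)// (kE z v)// -linearP; apply: kE.
  by rewrite linearP uy vz linearP.
have [g gE] := E_inj _ _ val (mk_linear k_lin) val_inj.
exists g => x; have fx : im_sub f (f x) by exists x.
by have := gE (mk_submod fx); rewrite /= => ->; exact: kE.
Qed.

Section InjectiveResolution.
Variable A : comNzRingType.

Record inj_resolution (M : lmodType A) := InjResolution {
  res_cpx :> cochain A;
  res_aug : {linear M -> res_cpx 0};
  res_injective : forall n, injective_module (res_cpx n);
  res_aug_inj : injective res_aug;
  res_exact0 : forall x, cdiff res_cpx 0 x = 0 <-> exists m, res_aug m = x;
  res_exactS : forall n x,
    cdiff res_cpx n.+1 x = 0 <-> exists y, cdiff res_cpx n y = x }.

Lemma res_aug_eq0 (M : lmodType A) (r : inj_resolution M) x :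
  res_aug r x = 0 -> x = 0.
Proof. by move=> x0; apply: (@res_aug_inj _ r); rewrite linear0. Qed.

(* An injective module containing M, not the injective envelope of M. *)
Definition inj_embed (M : lmodType A) : lmodType A :=
  coind A {h : M -> QmodZ | zmod_morphism h}.

Fact to_embed_subproof (M : lmodType A) (m : M)
    (h : {h : M -> QmodZ | zmod_morphism h}) :
  zmod_morphism (fun a : A => proj1_sig h (a *: m)).
Proof. by move=> a b; rewrite scalerBl (proj2_sig h). Qed.

Definition to_embed_fun (M : lmodType A) (m : M) : inj_embed M :=
  mk_coind (to_embed_subproof m).

Lemma to_embed_linear (M : lmodType A) : linear (@to_embed_fun M).
Proof.
move=> a x y; apply: val_inj; apply/funext => h; apply/funext => b /=.
rewrite scalerDr (zmod_morphismD (proj2_sig h)) scalerA mulrC.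
by [].
Qed.

Definition to_embed (M : lmodType A) : {linear M -> inj_embed M} :=
  mk_linear (@to_embed_linear M).

Lemma to_embed_inj (M : lmodType A) : injective (to_embed M).
Proof.
apply: raddf_inj => m m0; apply/eqP; apply: contraT => /QmodZ_separated[g gB].
have := congr1 (fun h : inj_embed M => val h (exist _ g gB) 1) m0.
by rewrite /= scale1r => ->; rewrite eqxx.
Qed.

Fixpoint cosyzygy (M : lmodType A) n : lmodType A :=
  if n is m.+1 then quotmod (im_sub (to_embed (cosyzygy M m))) else M.

Lemma inj_resolution_ex (M : lmodType A) : inhabited (inj_resolution M).
Proof.
pose E n := inj_embed (cosyzygy M n).
pose p n : {linear E n -> cosyzygy M n.+1} := qproj (im_sub (to_embed (cosyzygy M n))).
pose d n : {linear E n -> E n.+1} := to_embed (cosyzygy M n.+1) \o p n.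
have p0 n x : p n x = 0 <-> exists m, to_embed (cosyzygy M n) m = x.
  rewrite -(linear0 (p n)); split.
    by move=> /qproj_eq; rewrite subr0 => -[m _ mx]; exists m.
  by move=> [m <-]; apply/qproj_eq; rewrite subr0; exists m.
have d0 n x : d n x = 0 <-> p n x = 0.
  split=> [|px]; last first.
    by apply: etrans (congr1 (to_embed _) px) _; exact: linear0.
  by move=> dx; apply: (@to_embed_inj (cosyzygy M n.+1)); exact: etrans dx (esym (linear0 _)).
have dK n x : d n.+1 (d n x) = 0 by apply/d0/p0; exists (p n x).
exists; refine (@InjResolution M (@Cochain A E d dK) (to_embed M) _ _ _ _).
- by move=> n; exact: coind_injective.
- exact: to_embed_inj.
- by move=> x; exact: (iff_trans (d0 0 x) (p0 0 x)).
- move=> n x; split=> [/d0/p0[m <-]|[y <-]]; last exact: dK.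
  by have [y <-] := @qproj_surj _ _ (im_sub (to_embed (cosyzygy M n))) m; exists y.
Qed.

Definition inj_res (M : lmodType A) : inj_resolution M :=
  inhabited_witness (inj_resolution_ex M).

Lemma comparison (N : lmodType A) (X : inj_resolution N) (Y : cochain A)
    (c : {linear N -> Y 0}) :
  (forall n, injective_module (Y n)) -> (forall m, cdiff Y 0 (c m) = 0) ->
  exists phi : cochain_map X Y, forall m, phi 0 (res_aug X m) = c m.
Proof.
move=> Y_inj dc.
pose Q n (p : {linear X n -> Y n}) := forall x, cdiff X n x = 0 -> cdiff Y n (p x) = 0.
have [p0 p0E] : exists p : {linear X 0 -> Y 0}, forall m, p (res_aug X m) = c m.
  apply: injective_extend => // x /eqP; rewrite -(linear0 (res_aug X)).
  by rewrite (inj_eq (@res_aug_inj _ X)) => /eqP ->; rewrite linear0.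
have Q0 : Q 0 p0 by move=> _ /res_exact0[m <-]; rewrite p0E.
have step n (p : {p | Q n p}) : exists p' : {p' | Q n.+1 p'},
    forall x, sval p' (cdiff X n x) = cdiff Y n (sval p x).
  case: p => p Qp; have [p' p'E] := injective_extend (Y_inj n.+1) (h := cdiff Y n \o p) Qp.
  have Qp' : Q n.+1 p' by move=> _ /res_exactS[y <-]; rewrite p'E cdiffK.
  by exists (exist _ p' Qp').
pose F := nat_rect (fun n => {p | Q n p}) (exist _ p0 Q0)
  (fun n p => projT1 (cid (step n p))).
have FE n x : sval (F n.+1) (cdiff X n x) = cdiff Y n (sval (F n) x).
  by rewrite {1}/F /=; case: cid.
by exists (@CochainMap A X Y (fun n => sval (F n)) FE).
Qed.

Section Horseshoe.
Variables (M1 M2 M3 : lmodType A).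
Variables (f : {linear M1 -> M2}) (g : {linear M2 -> M3}).

(* A resolution of M2 sitting in a short exact sequence between given
   resolutions of M1 and M3, compatibly with f and g. *)
Record res_extension (E1 : inj_resolution M1) (E3 : inj_resolution M3) :=
  ResExtension {
    ext_res : inj_resolution M2;
    ext_f : cochain_map E1 ext_res;
    ext_g : cochain_map ext_res E3;
    ext_fE : forall m, ext_f 0 (res_aug E1 m) = res_aug ext_res (f m);
    ext_gE : forall m, ext_g 0 (res_aug ext_res m) = res_aug E3 (g m);
    ext_exact : forall n, short_exact (ext_f n) (ext_g n) }.

Hypothesis fg : short_exact f g.

Lemma horseshoe E1 E3 : inhabited (res_extension E1 E3).
Proof.
have [a aE] : exists a : {linear M2 -> E1 0}, forall m, a (f m) = res_aug E1 m.
  by apply: (@res_injective _ E1 0); exact: sex_inj fg.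
have da0 m : cdiff E1 0 (res_aug E1 m) = 0 by apply/res_exact0; exists m.
have [c cE] : exists c : {linear M3 -> E1 1}, forall m, c (g m) = - cdiff E1 0 (a m).
  apply: (injective_extend (h := \- (cdiff E1 0 \o a))); first exact: res_injective.
  by move=> _ /(sex_mid fg)[x <-] /=; rewrite aE da0 oppr0.
pose dN n : {linear E1 n.+1 -> E1 n.+2} := \- cdiff E1 n.+1.
have dNK n x : dN n.+1 (dN n x) = 0 by rewrite /= linearN cdiffK !oppr0.
pose Y := @Cochain A (fun n => E1 n.+1) dN dNK.
have [th thE] : exists th : cochain_map E3 Y, forall m, th 0 (res_aug E3 m) = c m.
  apply: comparison; first by move=> n; exact: res_injective.
  move=> m; have [y <-] := sex_surj fg m.
  by rewrite /= cE linearN opprK cdiffK.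
pose t n : {linear E3 n -> E1 n.+1} := th n.
have tE n x : t n.+1 (cdiff E3 n x) = - cdiff E1 n.+1 (t n x) by exact: cmapE th n x.
pose C n : lmodType A := (E1 n * E3 n)%type.
have d_lin n : linear (fun u : C n => (cdiff E1 n u.1 + t n u.2, cdiff E3 n u.2) : C n.+1).
  by move=> b [x1 x3] [y1 y3]; congr (_, _); rewrite /= !linearP //= scalerDr addrACA.
pose d n := mk_linear (d_lin n).
have dK n x : d n.+1 (d n x) = 0.
  by congr (_, _); rewrite /= ?linearD !cdiffK ?add0r ?tE ?subrr.
pose E2 := @Cochain A C d dK.
have e_lin : linear (fun m : M2 => (a m, res_aug E3 (g m)) : C 0).
  by move=> b x y; congr (_, _); rewrite /= !linearP.
pose e : {linear M2 -> E2 0} := mk_linear e_lin.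
have de m : d 0 (e m) = 0.
  congr (_, _); first by rewrite /= [t 0 _]thE cE subrr.
  by apply/res_exact0; exists (g m).
have E2_inj n : injective_module (E2 n).
  move=> X Z i h i_inj.
  have h1_lin : linear (fun x => (h x).1) by move=> b x y; rewrite linearP.
  have h2_lin : linear (fun x => (h x).2) by move=> b x y; rewrite linearP.
  have [k1 k1E] := @res_injective _ E1 n _ _ i (mk_linear h1_lin) i_inj.
  have [k2 k2E] := @res_injective _ E3 n _ _ i (mk_linear h2_lin) i_inj.
  have k_lin : linear (fun z => (k1 z, k2 z) : C n).
    by move=> b x y; congr (_, _); rewrite /= !linearP.
  exists (mk_linear k_lin) => x; rewrite [RHS]surjective_pairing.
  exact: congr2 (k1E x) (k2E x).
have e_inj : injective e.
  apply: raddf_inj => m em.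
  have am : a m = 0 := congr1 fst em.
  have /res_aug_eq0/(sex_mid fg)[x xm] : res_aug E3 (g m) = 0 := congr1 snd em.
  by move: am; rewrite -xm aE => /res_aug_eq0 ->; rewrite linear0.
have exact0 x : cdiff E2 0 x = 0 <-> exists m, e m = x.
  split=> [|[m <-]]; last exact: de.
  case: x => x1 x3 dx.
  have dx1 : cdiff E1 0 x1 + t 0 x3 = 0 := congr1 fst dx.
  have /res_exact0[m3 m3x] : cdiff E3 0 x3 = 0 := congr1 snd dx.
  have [m2 m23] := sex_surj fg m3.
  have /res_exact0[m1 m1x] : cdiff E1 0 (x1 - a m2) = 0.
    rewrite linearB; move: dx1; rewrite -m3x -m23 [t 0 _]thE cE.
    exact.
  exists (m2 + f m1); congr (_, _).
    by rewrite linearD aE m1x addrC subrK.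
  rewrite linearD; have -> : g (f m1) = 0 by apply/(sex_mid fg); exists m1.
  by rewrite addr0 m23 m3x.
have exactS n x : cdiff E2 n.+1 x = 0 <-> exists y, cdiff E2 n y = x.
  split=> [|[y <-]]; last exact: dK.
  case: x => x1 x3 dx.
  have dx1 : cdiff E1 n.+1 x1 + t n.+1 x3 = 0 := congr1 fst dx.
  have /res_exactS[y3 y3x] : cdiff E3 n.+1 x3 = 0 := congr1 snd dx.
  have /res_exactS[y1 y1x] : cdiff E1 n.+1 (x1 - t n y3) = 0.
    by rewrite linearB; move: dx1; rewrite -y3x tE.
  by exists (y1, y3); congr (_, _); rewrite //= y1x subrK.
pose R := @InjResolution M2 E2 e E2_inj e_inj exact0 exactS.
have i_lin n : linear (fun x : E1 n => (x, 0) : C n).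
  by move=> b x y; congr (_, _); rewrite /= scaler0 addr0.
have iE n x : mk_linear (i_lin n.+1) (cdiff E1 n x) = cdiff E2 n (mk_linear (i_lin n) x).
  by congr (_, _); rewrite /= !linear0 ?addr0.
have p_lin n : linear (fun x : C n => x.2) by [].
have pE n x : mk_linear (p_lin n.+1) (cdiff E2 n x) = cdiff E3 n (mk_linear (p_lin n) x).
  by [].
pose iota := @CochainMap A E1 E2 (fun n => mk_linear (i_lin n)) iE.
pose pr := @CochainMap A E2 E3 (fun n => mk_linear (p_lin n)) pE.
exists; refine (@ResExtension E1 E3 R iota pr _ _ _).
- move=> m; congr (_, _); first by rewrite /= aE.
  by rewrite /= [g _](_ : _ = 0) ?linear0//; apply/(sex_mid fg); exists m.
- by [].
- move=> n; split=> [x y [->]//|[y1 y3]|z]; last by exists (0, z).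
  by split=> [/= ->|[x [_ <-]]//]; exists y1.
Qed.

Definition horseshoe_res E1 E3 : res_extension E1 E3 :=
  inhabited_witness (horseshoe E1 E3).
End Horseshoe.
End InjectiveResolution.

Section LocalCohomology.
Variables (A : comNzRingType) (J : ideal A).

Section GammaComplex.
Variable C : cochain A.
Lemma Gamma_cdiffK n (x : Gamma J (C n)) :
  Gamma_map J (cdiff C n.+1) (Gamma_map J (cdiff C n) x) = 0.
Proof. by apply: val_inj; rewrite /= cdiffK. Qed.
Definition Gamma_cochain : cochain A :=
  @Cochain A (fun n => Gamma J (C n)) (fun n => Gamma_map J (cdiff C n)) Gamma_cdiffK.
End GammaComplex.

Section GammaComplexMap.
Variables (C D : cochain A) (f : cochain_map C D).
Lemma Gamma_cmapE n (x : Gamma J (C n)) :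
  Gamma_map J (f n.+1) (cdiff (Gamma_cochain C) n x) =
  cdiff (Gamma_cochain D) n (Gamma_map J (f n) x).
Proof. by apply: val_inj; rewrite /= cmapE. Qed.
Definition Gamma_cochain_map : cochain_map (Gamma_cochain C) (Gamma_cochain D) :=
  @CochainMap A (Gamma_cochain C) (Gamma_cochain D)
    (fun n => Gamma_map J (f n)) Gamma_cmapE.
End GammaComplexMap.

Lemma Gamma_short_exact (M1 M2 M3 : lmodType A)
    (f : {linear M1 -> M2}) (g : {linear M2 -> M3}) :
  injective_module M1 -> short_exact f g ->
  short_exact (Gamma_map J f) (Gamma_map J g).
Proof.
move=> M1_inj fg.
have [r rf] := M1_inj _ _ f (idfun : {linear M1 -> M1}) (sex_inj fg).
split=> [x y /(congr1 val)/= /(sex_inj fg)/val_inj //|y|z].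
  split=> [/(congr1 val)/= /(sex_mid fg)[x xy]|[x <-]]; last first.
    by apply: val_inj => /=; apply/(sex_mid fg); exists (val x).
  have tx : torsion_sub J M1 x.
    by rewrite -[x]rf xy; apply: torsion_sub_map; exact: submodP.
  by exists (mk_submod tx); apply: val_inj.
have [y yz] := sex_surj fg (val z).
have gf x : g (f x) = 0 by apply/(sex_mid fg); exists x.
have ty : torsion_sub J M2 (y - f (r y)).
  have [k kz] := submodP z; exists k => a Ja; have az := kz a Ja.
  have /(sex_mid fg)[x xy] : g (a *: y) = 0 by rewrite linearZ_LR yz.
  rewrite scalerBr -2!linearZ_LR -xy.
  by rewrite rf subrr.
exists (mk_submod ty); apply: val_inj.
by rewrite /= linearB gf subr0.
Qed.

(* H^i_J is the i-th right derived functor of the J-torsion functor Gamma J. *)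
Definition loc_coh (i : nat) (M : lmodType A) : lmodType A :=
  coh (Gamma_cochain (inj_res M)) i.

Section Map.
Variables (M N : lmodType A) (f : {linear M -> N}).

Lemma inj_res_map_ex : exists phi : cochain_map (inj_res M) (inj_res N),
  forall m, phi 0 (res_aug (inj_res M) m) = res_aug (inj_res N) (f m).
Proof.
have [] := @comparison A M (inj_res M) (inj_res N) (res_aug (inj_res N) \o f).
- exact: res_injective.
- by move=> m; apply/res_exact0; exists (f m).
- by move=> phi phiE; exists phi.
Qed.

Definition inj_res_map : cochain_map (inj_res M) (inj_res N) :=
  projT1 (cid inj_res_map_ex).

Definition loc_coh_map i : {linear loc_coh i M -> loc_coh i N} :=
  coh_map (Gamma_cochain_map inj_res_map) i.
End Map.

Section Delta.
Variables (M1 M2 M3 : lmodType A).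
Variables (f : {linear M1 -> M2}) (g : {linear M2 -> M3}).
Hypothesis fg : short_exact f g.

Let E2 := horseshoe_res fg (inj_res M1) (inj_res M3).

Lemma Gamma_horseshoe_exact n :
  short_exact (Gamma_cochain_map (ext_f E2) n) (Gamma_cochain_map (ext_g E2) n).
Proof. by apply: Gamma_short_exact; [exact: res_injective|exact: ext_exact]. Qed.

Definition loc_coh_delta i : {linear loc_coh i M3 -> loc_coh i.+1 M1} :=
  connecting Gamma_horseshoe_exact i.
End Delta.
End LocalCohomology.

Section Bockstein.
Variables (A : comNzRingType) (u : A).

Lemma mulby_linear : linear (fun x : A^o => u * x : A^o).
Proof. by move=> a x y; rewrite mulrDr; congr (_ + _); exact: mulrCA. Qed.
Definition mulby : {linear A^o -> A^o} := mk_linear mulby_linear.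
(* A / uA as an A-module. *)
Definition modby : lmodType A := quotmod (im_sub mulby).
Definition modby_proj : {linear A^o -> modby} := qproj (im_sub mulby).

Hypothesis u_reg : GRing.lreg u.

Lemma mulby_short_exact : short_exact mulby modby_proj.
Proof.
split; first exact: u_reg.
  move=> y; rewrite -(linear0 modby_proj); split.
    by move=> /qproj_eq; rewrite subr0 => -[x _ xy]; exists x.
  by move=> [x <-]; apply/qproj_eq; rewrite subr0; exists x.
exact: qproj_surj.
Qed.

(* pi^{i+1} \o delta^i : H^i_J(A/uA) -> H^{i+1}_J(A) -> H^{i+1}_J(A/uA). *)
Definition bockstein (J : ideal A) (i : nat) :
    {linear loc_coh J i modby -> loc_coh J i.+1 modby} :=
  loc_coh_map J modby_proj i.+1 \o loc_coh_delta J mulby_short_exact i.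
End Bockstein.

Definition principal (A : comNzRingType) (a : A) : ideal A := @gen_sub A A^o [set a].

(* The extension IB of the ideal I of A along f : A -> B. *)
Definition ext_ideal (A B : comNzRingType) (f : {rmorphism A -> B}) (I : ideal A) :
  ideal B := @gen_sub B B^o (f @` I).

Section RingT.
Variable p : nat.

Definition XYp : {mpoly int[2]} := 'X_0 * 'X_1 - p%:R.

Definition XYp_ideal : {pred {mpoly int[2]}} := fun f => `[< principal XYp f >].

Lemma principalP (A : comNzRingType) (a x : A) :
  principal a x <-> exists b, x = b * a.
Proof.
split=> [|[b ->] K aK]; last by apply: (smodZ b); exact: aK.
pose K := im_sub (mk_linear (mulby_linear a)).
have aK : [set a] `<=` K by move=> _ ->; exists 1 => //=; rewrite mulr1.
by move=> /(_ K aK) [b _ <-]; exists b; rewrite /= mulrC.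
Qed.

Lemma XYp_idealP f : reflect (exists q, f = q * XYp) (f \in XYp_ideal).
Proof. by apply: (iffP (asboolP _)) => /principalP. Qed.

Lemma XYp_ideal_closed : idealr_closed XYp_ideal.
Proof.
split; first by apply/XYp_idealP; exists 0; rewrite mul0r.
  apply/negP => /XYp_idealP[q /(congr1 (meval (fun i => if i == 0 then p%:R else 1)))].
  rewrite meval1 mevalM mevalB mevalM !mevalXU /= -mpolyC_nat mevalC.
  by rewrite mulr1 subrr mulr0.
move=> a f g /XYp_idealP[q ->] /XYp_idealP[r ->]; apply/XYp_idealP.
by exists (a * q + r); rewrite mulrDl mulrA.
Qed.
HB.instance Definition _ := isIdealr.Build _ XYp_ideal XYp_ideal_closed.

(* Z[X,Y] / (XY - p). *)
Definition ringT : comNzRingType := {ideal_quot XYp_ideal}.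

Definition int_ringT : {rmorphism int -> ringT} := intmul 1.

Lemma ringT_lreg : prime p -> GRing.lreg (p%:R : ringT).
Proof.
move=> p_pr; pose pi := \pi_ringT.
have pi0 f : pi f = 0 <-> exists q, f = q * XYp.
  have -> : 0 = pi 0 by rewrite /pi raddf0.
  split => [/eqP|fq]; first by rewrite -Quotient.idealrBE subr0 => /XYp_idealP.
  by apply/eqP; rewrite -Quotient.idealrBE subr0; apply/XYp_idealP.
have pz0 : (p%:Z != 0)%R by rewrite eqz_nat -lt0n prime_gt0.
suff reg0 (x : ringT) : p%:R * x = 0 -> x = 0.
  by move=> x y xy; apply/eqP; rewrite -subr_eq0; apply/eqP/reg0; rewrite mulrBr xy subrr.
have <- : pi (repr x) = x by exact: reprK.
move: (repr x) => f; have -> : p%:R * pi f = pi (p%:R * f).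
  by rewrite /pi rmorphM rmorph_nat.
move=> /pi0[q pf]; apply/pi0.
have pC (h : {mpoly int[2]}) m : (p%:R * h)@_m = p%:Z * h@_m.
  by rewrite mulr_natl mcoeffMn -mulr_natl natz.
pose e : 'X_{1..2} := (U_(0%R) + U_(1%R))%MM.
have pq m : (p %| q@_m)%Z.
  have := congr1 (mcoeff (e + m)%MM) pf.
  rewrite pC mulrBr mcoeffB -mpolyXD mcoeffMX [q * p%:R]mulrC pC => /eqP.
  by rewrite eq_sym subr_eq -mulrDr => /eqP ->; rewrite dvdz_mulr.
pose r := \sum_(m <- msupp q) (q@_m %/ p)%Z *: 'X_[m].
have qr : q = p%:R * r.
  rewrite [LHS]mpolyE mulr_sumr; apply: eq_bigr => m _.
  by rewrite mulr_natl scalerMnl -[_ *+ p]mulr_natr natz divzK.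
exists r; apply: (@mulfI _ p%:R); last by rewrite pf qr mulrA.
by apply: contraNneq pz0 => p0; have := pC 1 0%MM; rewrite p0 mul0r mcoeff0 mcoeff1 eqxx mulr1 => <-.
Qed.

End RingT.

(* Main.v *)
(** If [p] divides [n], then [IT] annihilates [T/pT], and a module annihilated by
    [J] has no [H^1_J]: if [dy] is a [J]-torsion cocycle of an injective
    resolution, then [J^k y] lies in the module, so [J^(k+1) y = 0] and [dy] is the
    coboundary of a torsion element.  If [p] does not divide [n], a Bezout relation
    makes some element of [IT] act as the identity on [T/pT], which then has no
    [IT]-torsion and hence no [H^0_{IT}].  So the source or the target of the Bockstein
    map is zero. *)
Require Import Defs.
From mathcomp Require Import all_boot all_order all_algebra.
Import GRing.Theory.
Local Open Scope ring_scope.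

Lemma coh_eq0 (A : comNzRingType) (C : cochain A) (n : nat) :
  (forall x : C n, cdiff C n x = 0 -> is_coboundary x) ->
  forall z : coh C n, z = 0.
Proof.
move=> exactC z; have [x <-] := qproj_surj z.
rewrite -(linear0 (qproj (coboundaries C n))); apply/qproj_eq.
rewrite subr0; exact/exactC/(submodP x).
Qed.

Section LocalCohomologyVanishing.
Variables (A : comNzRingType) (J : ideal A) (M : lmodType A).

Lemma ideal_pow_expr (a : A) (k : nat) : J a -> ideal_pow J k (a ^+ k).
Proof.
move=> Ja; elim: k => [//|k IH] N; apply.
by exists a, (a ^+ k); rewrite exprS.
Qed.

Lemma loc_coh1_eq0 :
  (forall (a : A) (m : M), J a -> a *: m = 0) ->
  forall z : loc_coh J 1 M, z = 0.
Proof.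
move=> JM0; apply: coh_eq0 => x /(congr1 val) /= /res_exactS[y dy].
suff ty : torsion_sub J _ y by exists (mk_submod ty); apply: val_inj.
have [k kx] := submodP x; exists k.+1 => a Ja.
have y_lin : linear (fun b : A^o => b *: y) by move=> b c d; rewrite scalerDl scalerA.
(* The elements killing [y] form an ideal, so it is enough to test the generators [b * c] of the
   power [k.+1] of [J]. *)
apply: (Ja (ker_sub (mk_linear y_lin))) => _ [b [c [Jb Jc ->]]] /=.
have /res_exact0[m my] : cdiff (inj_res M) 0 (c *: y) = 0 by rewrite linearZ_LR dy kx.
by rewrite -scalerA -my -linearZ_LR JM0 ?linear0.
Qed.

Lemma loc_coh0_eq0 (a : A) :
  J a -> (forall m : M, a *: m = m) -> forall z : loc_coh J 0 M, z = 0.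
Proof.
move=> Ja aM; apply: coh_eq0 => x /(congr1 val) /= /res_exact0[m mx].
have [k kx] := submodP x; apply: val_inj => /=; rewrite -mx.
(* [a ^+ k] fixes [m], yet it lies in the power of [J] that kills the image of [m]. *)
have -> : m = a ^+ k *: m.
  by elim: k {kx} => [|k IH]; rewrite ?scale1r // exprSr -scalerA aM.
by rewrite linearZ_LR mx kx //; exact: ideal_pow_expr.
Qed.
End LocalCohomologyVanishing.

Lemma scale_modby (A : comNzRingType) (u b : A) (m : modby u) : (u * b) *: m = 0.
Proof.
have [x <-] := qproj_surj m.
rewrite -linearZ_LR -(linear0 (qproj (im_sub (mulby u)))); apply/qproj_eq.
by rewrite subr0; exists (b * x) => //=; rewrite mulrA.
Qed.

Theorem proposition5p2 (p : nat) (p_prime : prime p) (n : int) (I : ideal int)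
    (I_def : I = principal n)
    (z : loc_coh (ext_ideal (int_ringT p) I) 0 (modby (p%:R : ringT p))) :
  bockstein (ringT_lreg p_prime) (ext_ideal (int_ringT p) I) 0 z = 0.
Proof.
have pE : int_ringT p p = p%:R by [].
have [pn|pn] := boolP (p %| n)%Z.
  apply: loc_coh1_eq0 => a m Ja.
  (* [IT] lies in [pT]: only images of elements of [I] need checking. *)
  have [|b _ <-] := Ja (im_sub (mulby (p%:R : ringT p))); last exact: scale_modby.
  move=> _ [i + <-]; rewrite I_def => /principalP[c ->].
  have [d ->] := dvdzP pn.
  exists (int_ringT p (c * d)) => //=.
  by rewrite -pE -rmorphM mulrC -mulrA.
have /coprimezP[[v w] /= vw] : coprimez n p.
  by rewrite coprimezE coprime_sym prime_coprime.
suff -> : z = 0 by exact: (linear0 (bockstein _ _ 0)).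
(* [v * n] is 1 modulo [p], hence acts as the identity on [T/pT]. *)
apply: (@loc_coh0_eq0 _ _ _ (int_ringT p (v * n))) => [|m].
  move=> N; apply; exists (v * n) => //.
  by rewrite I_def; apply/principalP; exists v.
have -> : v * n = 1 - p%:Z * w by rewrite -vw [_ * w]mulrC addrK.
rewrite rmorphB rmorphM rmorph1 pE scalerBl scale1r.
by rewrite [_ *: m]scale_modby subr0.
Qed.
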